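(* Let $(L,\delta_L^* )$ be an iterative $q$-difference field of positive characteristic $p$. Then the category $Proj_q(L)$ is equivalent to the category $IDM_q(L)$ of iterative $q$-difference modules over $L$.
   Context: Let $C$ be an algebraically closed field of characteristic $p>0$ and $q\in C$ a primitive $n$-th root of unity, $n\ge2$; $F=C(t)$ with $\sigma_q(f(t))=f(qt)$; $\binom{r}{k}_q$ is the value at $q$ of the Gaussian polynomial $\prod_{i=1}^{k}\frac{1-x^{r-i+1}}{1-x^{i}}$. An iterative $q$-difference field is a field $L\supseteq F$ with an automorphism $\sigma_q$ extending that of $F$ and maps $\delta_L^{(k)}$ ($k\in\mathbb N$) satisfying: $\delta_L^{(0)}=\mathrm{id}$, $\delta_L^{(1)}=\frac{\sigma_q-\mathrm{id}}{(q-1)t}$, additivity, $\delta_L^{(k)}(ab)=\sum_{i+j=k}\sigma_q^i(\delta_L^{(j)}(a))\delta_L^{(i)}(b)$, $\delta_L^{(i)}\circ\delta_L^{(j)}=\binom{i+j}{i}_q\delta_L^{(i+j)}$. The category $IDM_q(L)$: objects are finite-dimensional $L$-vector spaces $M$ with maps $\delta_M^{(k)}$ such that $\delta_M^{(0)}=\mathrm{id}$, $(q-1)t\delta_M^{(1)}+\mathrm{id}$ is bijective, each $\delta_M^{(k)}$ is additive, $\delta_M^{(k)}(am)=\sum_{i+j=k}\sigma_q^i(\delta_L^{(j)}(a))\delta_M^{(i)}(m)$, $\delta_M^{(i)}\circ\delta_M^{(j)}=\binom{i+j}{i}_q\delta_M^{(i+j)}$; morphisms are $L$-linear maps commuting with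 all $\delta^{(k)}$. Put $L_0=L$ and, for $k\ge0$, $L_{k+1}=\mathrm{Ker}(\delta_L^{(1)})\cap\bigcap_{0\le j<k}\mathrm{Ker}(\delta_L^{(np^j)})$ (so $L_1=\mathrm{Ker}\,\delta_L^{(1)}$). The category $Proj_q(L)$ has as objects projective systems $(N_k,\psi_k)_{k\in\mathbb N}$ where $N_k$ is a finite-dimensional $L_k$-vector space, $\psi_k:N_{k+1}\to N_k$ is $L_{k+1}$-linear, and each $\psi_k$ extends (uniquely) to an $L_k$-linear isomorphism $L_k\otimes_{L_{k+1}}N_{k+1}\to N_k$; morphisms $(M_k,\phi_k)\to(N_k,\psi_k)$ are families of $L_k$-linear maps $\alpha_k:M_k\to N_k$ with $\alpha_k\circ\phi_k=\psi_k\circ\alpha_{k+1}$ for all $k$. *)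

(* Defs.v *)
From HB Require Import structures.
From mathcomp Require Import all_boot all_algebra.
Set Implicit Arguments. Unset Strict Implicit. Unset Printing Implicit Defensive.
Import GRing.Theory.
Local Open Scope ring_scope.

Record Category := MkCategory {
  Ob : Type;
  Hom : Ob -> Ob -> Type;
  idC : forall a, Hom a a;
  compC : forall a b c, Hom b c -> Hom a b -> Hom a c }.

Arguments idC {_} a.
Arguments compC {_ a b c} g f.

Record Functor (C D : Category) := MkFunctor {
  Fob : Ob C -> Ob D;
  Fhom : forall a b, Hom a b -> Hom (Fob a) (Fob b);
  Fid : forall a, Fhom (idC a) = idC (Fob a);
  Fcomp : forall a b c (g : Hom b c) (f : Hom a b),
            Fhom (compC g f) = compC (Fhom g) (Fhom f) }.

Arguments Fob {C D} _ _.
Arguments Fhom {C D} _ {a b} _.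

Definition isIso (C : Category) (a b : Ob C) (f : Hom a b) : Prop :=
  exists g : Hom b a, compC g f = idC a /\ compC f g = idC b.

Definition EquivalentCategories (C D : Category) : Prop :=
  exists (F : Functor C D) (G : Functor D C),
    (exists eta : forall a, Hom (Fob G (Fob F a)) a,
        (forall a b (f : Hom a b), compC f (eta a) = compC (eta b) (Fhom G (Fhom F f)))
        /\ (forall a, isIso (eta a)))
    /\
    (exists eps : forall b, Hom (Fob F (Fob G b)) b,
        (forall a b (f : Hom a b), compC f (eps a) = compC (eps b) (Fhom F (Fhom G f)))
        /\ (forall b, isIso (eps b))).

Section QDiff.
Variables (C : closedFieldType) (L : fieldType) (iota : {rmorphism C -> L}).
Variables (q : C) (t : L) (sigma : {rmorphism L -> L}) (delta : nat -> L -> L).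

(* value at q of the Gaussian polynomial prod_{i=1}^k (1-x^(r-i+1))/(1-x^i),
   the quotient being the (exact) polynomial quotient; embedded in L. *)
Definition gauss_binom (r k : nat) : L :=
  iota (((\prod_(1 <= i < k.+1) (1 - 'X^(r.+1 - i)))
          %/ (\prod_(1 <= i < k.+1) (1 - 'X^i)) : {poly C}).[q]).

Definition iterative_qdiff_field : Prop :=
  (* F = C(t) embeds in L: t is transcendental over iota(C) *)
  (forall P : {poly C}, P != 0 -> (map_poly iota P).[t] != 0)
  (* sigma is an automorphism of L extending sigma_q on C(t) *)
  /\ bijective sigma
  /\ (forall c, sigma (iota c) = iota c)
  /\ sigma t = iota q * t
  /\ (forall x, delta 0 x = x)
  /\ (forall x, delta 1 x = (sigma x - x) / ((iota q - 1) * t))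
  /\ (forall k x y, delta k (x + y) = delta k x + delta k y)
  /\ (forall k a b, delta k (a * b) =
        \sum_(i < k.+1) iter i sigma (delta (k - i) a) * delta i b)
  /\ (forall i j x, delta i (delta j x) = gauss_binom (i + j) i * delta (i + j) x).

Definition is_IDM (M : vectType L) (dM : nat -> M -> M) : Prop :=
  (forall m, dM 0 m = m)
  /\ bijective (fun m => ((iota q - 1) * t) *: dM 1 m + m)
  /\ (forall k m m', dM k (m + m') = dM k m + dM k m')
  /\ (forall k (a : L) m, dM k (a *: m) =
        \sum_(i < k.+1) iter i sigma (delta (k - i) a) *: dM i m)
  /\ (forall i j m, dM i (dM j m) = gauss_binom (i + j) i *: dM (i + j) m).

Record IDMobj := MkIDM {
  idm_space : vectType L;
  idm_delta : nat -> idm_space -> idm_space;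
  idm_ax : is_IDM idm_delta }.

Definition IDMhom_prop (M N : IDMobj) (f : idm_space M -> idm_space N) : Prop :=
  (forall (a : L) x y, f (a *: x + y) = a *: f x + f y)
  /\ (forall k x, f (@idm_delta M k x) = @idm_delta N k (f x)).

Definition IDMhom (M N : IDMobj) := {f : idm_space M -> idm_space N | IDMhom_prop f}.

Lemma IDMhom_id_prop (M : IDMobj) : IDMhom_prop (fun x : idm_space M => x).
Proof. by split. Qed.

Lemma IDMhom_comp_prop (M N P : IDMobj) (g : IDMhom N P) (f : IDMhom M N) :
  IDMhom_prop (fun x => proj1_sig g (proj1_sig f x)).
Proof.
case: g => g [g1 g2]; case: f => f [f1 f2]; split => /=.
  by move=> a x y; rewrite f1 g1.
by move=> k x; rewrite f2 g2.
Qed.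

Definition IDMCat : Category :=
  @MkCategory IDMobj IDMhom
    (fun M => exist _ _ (IDMhom_id_prop M))
    (fun M N P g f => exist _ _ (IDMhom_comp_prop g f)).

Variables (p n : nat).

Definition Lk (k : nat) (x : L) : Prop :=
  match k with
  | 0 => True
  | k'.+1 => delta 1 x = 0 /\ (forall j, (j < k')%N -> delta (n * p ^ j) x = 0)
  end.

Definition ks_basis (K : L -> Prop) (V : zmodType) (sc : L -> V -> V) (e : seq V) : Prop :=
  (forall v, exists c : nat -> L, (forall i, K (c i)) /\
       v = \sum_(i < size e) sc (c i) e`_i)
  /\ (forall c : nat -> L, (forall i, K (c i)) ->
       \sum_(i < size e) sc (c i) e`_i = 0 -> forall i, (i < size e)%N -> c i = 0).

Record KSpace (K : L -> Prop) := MkKSpace {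
  ks_car : zmodType;
  ks_scale : L -> ks_car -> ks_car;
  ks_scaleDr : forall a u v, K a -> ks_scale a (u + v) = ks_scale a u + ks_scale a v;
  ks_scaleDl : forall a b u, K a -> K b -> ks_scale (a + b) u = ks_scale a u + ks_scale b u;
  ks_scaleA : forall a b u, K a -> K b -> ks_scale (a * b) u = ks_scale a (ks_scale b u);
  ks_scale1 : forall u, ks_scale 1 u = u;
  ks_findim : exists e : seq ks_car, ks_basis K ks_scale e }.

Definition klinear (K : L -> Prop) (V W : zmodType) (scV : L -> V -> V)
    (scW : L -> W -> W) (f : V -> W) : Prop :=
  forall a x y, K a -> f (scV a x + y) = scW a (f x) + f y.

Record ProjObj := MkProj {
  pN : forall k, KSpace (Lk k);
  pPsi : forall k, ks_car (pN k.+1) -> ks_car (pN k);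
  pPsi_lin : forall k, klinear (Lk k.+1) (@ks_scale _ (pN k.+1)) (@ks_scale _ (pN k)) (@pPsi k);
  (* the L_k-linear extension L_k (x)_{L_{k+1}} N_{k+1} -> N_k is an isomorphism,
     i.e. psi_k maps an L_{k+1}-basis of N_{k+1} to an L_k-basis of N_k *)
  pPsi_ext : forall k, exists e, ks_basis (Lk k.+1) (@ks_scale _ (pN k.+1)) e
                        /\ ks_basis (Lk k) (@ks_scale _ (pN k)) (map (@pPsi k) e) }.

Definition Projhom_prop (M N : ProjObj)
    (al : forall k, ks_car (pN M k) -> ks_car (pN N k)) : Prop :=
  (forall k, klinear (Lk k) (@ks_scale _ (pN M k)) (@ks_scale _ (pN N k)) (al k))
  /\ (forall k x, al k (@pPsi M k x) = @pPsi N k (al k.+1 x)).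

Definition Projhom (M N : ProjObj) :=
  {al : forall k, ks_car (pN M k) -> ks_car (pN N k) | Projhom_prop al}.

Lemma Projhom_id_prop (M : ProjObj) :
  Projhom_prop (fun k (x : ks_car (pN M k)) => x).
Proof. by split. Qed.

Lemma Projhom_comp_prop (M N P : ProjObj) (g : Projhom N P) (f : Projhom M N) :
  Projhom_prop (fun k x => proj1_sig g k (proj1_sig f k x)).
Proof.
case: g => g [g1 g2]; case: f => f [f1 f2]; split => /=.
  by move=> k a x y Ka; rewrite f1 // g1.
by move=> k x; rewrite f2 g2.
Qed.

Definition ProjCat : Category :=
  @MkCategory ProjObj Projhom
    (fun M => exist _ _ (Projhom_id_prop M))
    (fun M N P g f => exist _ _ (Projhom_comp_prop g f)).

End QDiff.

(* Main.v *)
(* The common kernel M_k of the [delta j], 0 < j < n p^(k-1), spans a module M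
   over L: if [delta j m] is the top nonzero derivative of [m] in this range, it
   lies in M_k and [m - t ^ j *: delta j m] has a lower top derivative, because
   [delta j (t ^ j) = 1].  Hence M has an L-basis inside M_k; since the [delta j]
   act on coordinates in such a basis, it is also an L_i-basis of M_i for every
   i <= k, and (M_k) is an object of Proj_q(L).  The values of [delta j] on powers
   of [t], all forced by the axioms, determine the q-binomial coefficients through
   [delta i (delta j (t ^ (i + j))) = binom(i + j, i)_q], which replaces Lucas'
   theorem.  Conversely, a projective system (N_k) is embedded in N_0, where any
   basis coming from N_k is an L-basis, and [delta j] is defined coordinatewise in
   a basis coming from a high enough level; it does not depend on that level. *)
Require Import Defs.
From HB Require Import structures.
From mathcomp Require Import all_boot all_algebra.
From mathcomp Require Import boolp.
Set Implicit Arguments. Unset Strict Implicit. Unset Printing Implicit Defensive.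
Import GRing.Theory.
Local Open Scope ring_scope.

(** * Gaussian binomials: symmetry and lower index 1 *)

Section GaussianBinomial.
Variables (C : closedFieldType) (L : fieldType) (io : {rmorphism C -> L}) (q : C).
Local Notation gauss := (gauss_binom io q).
Let Q k : {poly C} := \prod_(1 <= i < k.+1) (1 - 'X^i).
Let P r k : {poly C} := \prod_(1 <= i < k.+1) (1 - 'X^(r.+1 - i)).

Let Q_neq0 k : Q k != 0.
Proof.
rewrite prodf_seq_neq0; apply/allP => i; rewrite mem_index_iota => /andP[i0 _] /=.
by rewrite -opprB oppr_eq0 -size_poly_gt0 size_XnsubC.
Qed.

(** [P (i + j) i] collects the factors with exponents from [j + 1] to [i + j], and [Q j] supplies
    the missing ones. *)
Let PQ i j : P (i + j) i * Q j = Q (i + j).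
Proof.
elim: i => [|i IH]; first by rewrite /P big_nil mul1r.
rewrite /P big_nat_recl // big_add1 /= subn1 /=.
rewrite [X in _ * X * _](_ : _ = P (i + j) i).
  by rewrite -mulrA IH /Q addSn [RHS]big_nat_recr //= mulrC.
by rewrite /P big_add1 /=; apply: eq_bigr => l _; rewrite subSS.
Qed.

(** The cancellation takes place among polynomials, before evaluation, because [Q i] may vanish at
    [q]; the resulting form is symmetric in [i] and [j]. *)
Let gauss_binomE i j : gauss (i + j) i = io ((Q (i + j) %/ (Q i * Q j)).[q]).
Proof.
rewrite /gauss_binom -/(P _ _) -/(Q _).
by rewrite -(@divp_pmul2l _ (Q j)) // mulrC PQ (mulrC (Q j)).
Qed.

Lemma gauss_binom_sym i j : gauss (i + j) i = gauss (i + j) j.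
Proof. by rewrite gauss_binomE addnC gauss_binomE (mulrC (Q i)). Qed.

Lemma gauss_binom1 r : gauss r 1 = io (\sum_(i < r) q ^+ i).
Proof.
rewrite /gauss_binom !big_nat1 subn1 /= expr1; congr (io _).
rewrite -[X in X %/ _]opprB -[X in _ %/ X]opprB subrX1 -mulNr mulKp.
  by rewrite horner_sum; apply: eq_bigr => i _; rewrite hornerXn.
by rewrite oppr_eq0 polyXsubC_eq0.
Qed.
End GaussianBinomial.

(** * Iterative [q]-derivations on the field [L] *)

Section IterativeDerivation.
Variables (C : closedFieldType) (p : nat) (hp : p \in [pchar C]).
Variables (n : nat) (hn : (2 <= n)%N) (q : C) (hq : n.-primitive_root q).
Variables (L : fieldType) (io : {rmorphism C -> L}) (t : L).
Variables (sigma : {rmorphism L -> L}) (delta : nat -> L -> L).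
Hypothesis hL : iterative_qdiff_field io q t sigma delta.
Local Notation gauss := (gauss_binom io q).

Lemma qdiff_var_neq0 : t != 0.
Proof. by have := hL.1 _ (negbT (polyX_eq0 C)); rewrite map_polyX hornerX. Qed.

Lemma sigma_const c : sigma (io c) = io c.
Proof. by case: hL => _ [_ []]. Qed.

Lemma sigma_var : sigma t = io q * t.
Proof. by case: hL => _ [_ [_ []]]. Qed.

Lemma delta0 x : delta 0 x = x.
Proof. by case: hL => _ [_ [_ [_ []]]]. Qed.

Lemma delta1 x : delta 1 x = (sigma x - x) / ((io q - 1) * t).
Proof. by case: hL => _ [_ [_ [_ [_ []]]]]. Qed.

Lemma deltaD k x y : delta k (x + y) = delta k x + delta k y.
Proof. by case: hL => _ [_ [_ [_ [_ [_ []]]]]]. Qed.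

Lemma deltaM k a b :
  delta k (a * b) = \sum_(i < k.+1) iter i sigma (delta (k - i) a) * delta i b.
Proof. by case: hL => _ [_ [_ [_ [_ [_ [_ []]]]]]]. Qed.

Lemma delta_delta i j x : delta i (delta j x) = gauss (i + j) i * delta (i + j) x.
Proof. by case: hL => _ [_ [_ [_ [_ [_ [_ [_ ]]]]]]]. Qed.

Lemma delta_x0 k : delta k 0 = 0.
Proof. by apply: (@addrI _ (delta k 0)); rewrite -deltaD !addr0. Qed.

Lemma deltaN k x : delta k (- x) = - delta k x.
Proof. by apply: (@addrI _ (delta k x)); rewrite -deltaD !subrr delta_x0. Qed.

Lemma delta_mulrn k x m : delta k (x *+ m) = delta k x *+ m.
Proof. by elim: m => [|m IH]; rewrite ?delta_x0 // !mulrS deltaD IH. Qed.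

Lemma iter_sigma0 i : iter i sigma 0 = 0.
Proof. by elim: i => //= i ->; rewrite rmorph0. Qed.

Lemma iter_sigma1 i : iter i sigma 1 = 1.
Proof. by elim: i => //= i ->; rewrite rmorph1. Qed.

Lemma iter_sigma_const i c : iter i sigma (io c) = io c.
Proof. by elim: i => //= i ->; rewrite sigma_const. Qed.

Lemma iter_sigma_var i : iter i sigma t = io (q ^+ i) * t.
Proof.
elim: i => [|i IH] /=; first by rewrite expr0 rmorph1 mul1r.
by rewrite IH rmorphM sigma_const sigma_var mulrA -rmorphM exprSr.
Qed.

Lemma const_subr1_neq0 : io q - 1 != 0.
Proof.
rewrite subr_eq0 fmorph_eq1; apply/eqP => q1.
by have := prim_order_dvd hq 1; rewrite q1 expr1n eqxx dvdn1 gtn_eqF.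
Qed.

Lemma sigma_delta1 x : sigma x = ((io q - 1) * t) * delta 1 x + x.
Proof.
by rewrite delta1 mulrC divfK ?subrK // mulf_neq0 ?const_subr1_neq0 ?qdiff_var_neq0.
Qed.

Lemma delta1_eq0 x : delta 1 x = 0 -> sigma x = x.
Proof. by rewrite sigma_delta1 => ->; rewrite mulr0 add0r. Qed.

Lemma iter_sigma_fix x i : delta 1 x = 0 -> iter i sigma x = x.
Proof. by move=> /delta1_eq0 sx; elim: i => //= i ->. Qed.

(** Isolates the terms [i = 0] and [i = j] of the Leibniz rule, for inductions in which the middle
    terms vanish. *)
Lemma deltaM_ends j x y : (0 < j)%N ->
  (forall i, (0 < i < j)%N -> iter i sigma (delta (j - i) x) * delta i y = 0) ->
  delta j (x * y) = delta j x * y + iter j sigma x * delta j y.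
Proof.
case: j => // j _ H; rewrite deltaM big_ord_recl big_ord_recr /= subn0 delta0.
rewrite big1 ?add0r; first by rewrite /bump /= add1n subnn delta0.
by move=> i _; rewrite /bump /= add1n; apply: (H i.+1); rewrite /= ltnS ltn_ord.
Qed.

(** By induction the middle terms for [1 * 1] vanish, so [delta j 1] equals its own double. *)
Lemma delta_1 j : (0 < j)%N -> delta j 1 = 0.
Proof.
elim/ltn_ind: j => j IH j0.
have := @deltaM_ends j 1 1 j0; rewrite iter_sigma1 mul1r => H; move: H.
move=> H; apply: (@addrI _ (delta j 1)); rewrite addr0 -{1}[delta j 1]mulr1 -{2}[delta j 1]mul1r -H ?mulr1 // => i /andP[i0 ij].
by rewrite [X in _ * X]IH // mulr0.
Qed.

Lemma delta1_var : delta 1 t = 1.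
Proof.
rewrite delta1 sigma_var -{2}[t]mul1r -mulrBl divff //.
by rewrite mulf_neq0 ?const_subr1_neq0 ?qdiff_var_neq0.
Qed.

(** This binomial is the [q]-integer [(q ^ j - 1) / (q - 1)], and [n] is the exact order of [q]. *)
Lemma gauss_binom1_eq0 j : (gauss j 1 == 0) = (n %| j)%N.
Proof.
rewrite gauss_binom1 fmorph_eq0 (prim_order_dvd hq) -(subr_eq0 (_ ^+ _)) subrX1 mulf_eq0.
by rewrite -(fmorph_eq0 io (q - 1)) rmorphB rmorph1 (negPf const_subr1_neq0).
Qed.

Lemma delta_delta1 j x : delta j (delta 1 x) = gauss j.+1 1 * delta j.+1 x.
Proof. by rewrite delta_delta gauss_binom_sym addn1. Qed.

Lemma delta1_delta j x : delta 1 (delta j x) = gauss j.+1 1 * delta j.+1 x.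
Proof. by rewrite delta_delta add1n. Qed.

(** [delta j.-1 (delta 1 x)] is a [q]-integer times [delta j x], and that [q]-integer is nonzero
    unless [n] divides [j]. *)
Lemma delta_ndvd j x : delta 1 x = 0 -> ~~ (n %| j)%N -> delta j x = 0.
Proof.
case: j => [|j] x1; first by rewrite dvdn0.
rewrite -gauss_binom1_eq0 => g; apply: (mulfI g).
by rewrite -delta_delta1 x1 delta_x0 mulr0.
Qed.

(** No axiom says that the higher [delta j] kill constants. For [q] this follows by induction on
    [j]: multiplication by [q] then obeys the ordinary Leibniz rule, so differentiating [q ^ n = 1]
    gives [n * delta j q = 0], and [n] is nonzero in [C]. *)
Lemma delta_root j : (0 < j)%N -> delta j (io q) = 0.
Proof.
elim/ltn_ind: j => j IH j0.
have H y : delta j (io q * y) = delta j (io q) * y + io q * delta j y.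
  rewrite deltaM_ends ?iter_sigma_const // => i /andP[i0 ij].
  by rewrite IH ?iter_sigma0 ?mul0r // ?subn_gt0 // ltn_subrL i0.
have Hm m : delta j (io q ^+ m) * io q = delta j (io q) * io q ^+ m *+ m.
  elim: m => [|m IHm]; first by rewrite expr0 delta_1 // mul0r mulr0n.
  rewrite exprS H mulrDl -!mulrA IHm (mulrC (io q ^+ m)) mulrnAr.
  by rewrite (mulrCA (io q) (delta j _)) -!exprS mulrS.
have /esym/eqP := Hm n; rewrite -rmorphXn prim_expr_order // rmorph1 delta_1 // mul0r.
rewrite mulr1 -mulr_natr mulf_eq0 => /orP[/eqP//|].
by rewrite -(rmorph_nat io) fmorph_eq0 (negPf (prim_root_natf_neq0 hq)).
Qed.

Lemma delta1M x y : delta 1 (x * y) = delta 1 x * y + sigma x * delta 1 y.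
Proof. by rewrite deltaM_ends // => -[|i]. Qed.

Lemma delta1C j x : delta 1 (delta j x) = delta j (delta 1 x).
Proof. by rewrite delta1_delta delta_delta1. Qed.

Lemma delta_rootM j x : delta j (io q * x) = io q * delta j x.
Proof.
case: j => [|j]; first by rewrite !delta0.
rewrite deltaM_ends // ?delta_root // ?mul0r ?add0r ?iter_sigma_const //.
by move=> i /andP[i0 ij]; rewrite delta_root ?iter_sigma0 ?mul0r // subn_gt0.
Qed.

(* For [n | j], comparing [delta 1 (delta j (t ^ 2))] with
   [delta j (delta 1 (t ^ 2))] gives [2 * delta j t = (1 + q) * delta j t]. *)
Lemma delta_var j : (1 < j)%N -> delta j t = 0.
Proof.
elim/ltn_ind: j => -[//|j] IH j1.
have tj : delta 1 (delta j.+1 t) = 0 by rewrite delta1C delta1_var delta_1.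
have [nj|] := boolP (n %| j.+1)%N; last first.
  rewrite -gauss_binom1_eq0 => g; apply: (mulfI g).
  by rewrite -delta_delta1 delta1_var mulr0 delta_1.
(* [c] is the sum of the middle Leibniz terms: it is 1 when [j.+1 = 2] and, by induction, 0
   beyond. *)
have [c c0 jtt] : exists2 c, delta 1 c = 0 &
    delta j.+1 (t * t) = delta j.+1 t * t + c + t * delta j.+1 t.
  have Et : iter j.+1 sigma t = t.
    by rewrite iter_sigma_var; move: nj; rewrite (prim_order_dvd hq) => /eqP->; rewrite rmorph1 mul1r.
  case: j j1 IH Et {tj nj} => [//|[|j]] _ IH Et.
    exists 1; first by rewrite delta_1.
    rewrite deltaM !big_ord_recl big_ord0 /= /bump /= !delta0 !delta1_var.
    by rewrite rmorph1 mulr1 addr0 addrA -[X in _ + X * _]Et.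
  exists 0; first by rewrite delta_x0.
  rewrite addr0 deltaM_ends ?Et // => -[|[|i]] // /andP[_ ij]; last by rewrite (IH i.+2) ?mulr0.
  by rewrite subn1 /= IH // rmorph0 mul0r.
have := delta1C j.+1 (t * t).
rewrite jtt !deltaD !delta1M tj c0 delta1_var !mulr0 !mul1r !mulr1 !addr0 deltaD.
rewrite sigma_var delta_rootM delta1_eq0 // mul0r add0r => /addrI/eqP.
rewrite -subr_eq0 -{1}[delta _ _]mul1r -mulrBl mulf_eq0 -opprB oppr_eq0.
by rewrite (negPf const_subr1_neq0) => /eqP.
Qed.

(** By [delta_var] only the last two terms of the Leibniz rule survive; this recursion governs the
    values on powers of [t]. *)
Lemma delta_varM j x : delta j.+1 (t * x) = delta j x + io (q ^+ j.+1) * t * delta j.+1 x.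
Proof.
rewrite deltaM big_ord_recr /= subnn delta0 -/(iter j.+1 sigma t) iter_sigma_var.
rewrite big_ord_recr /= subSnn delta1_var iter_sigma1 mul1r big1 ?add0r // => i _.
by rewrite delta_var ?iter_sigma0 ?mul0r // subSn ?ltnS ?subn_gt0 // ltnW.
Qed.

Lemma delta_varX_gt j m : (m < j)%N -> delta j (t ^+ m) = 0.
Proof.
elim: m j => [|m IH] [|j] // mj; first by rewrite delta_1.
by rewrite exprS delta_varM !IH ?mulr0 ?addr0 // ltnW.
Qed.

Lemma delta_varX m : delta m (t ^+ m) = 1.
Proof.
elim: m => [|m IH]; first by rewrite delta0.
by rewrite exprS delta_varM IH delta_varX_gt // mulr0 addr0.
Qed.

Lemma gauss_binom_delta i j : gauss (i + j) i = delta i (delta j (t ^+ (i + j))).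
Proof. by rewrite delta_delta delta_varX mulr1. Qed.

(** * Reduction of all [delta j] to [delta 1] and the [delta (n * p ^ i)] *)

Local Notation B i := (n * p ^ i)%N.

Let n_gt0 : (0 < n)%N. Proof. exact: ltnW hn. Qed.

Let p_pr : prime p. Proof. exact: pcharf_prime hp. Qed.

(** The middle Leibniz terms vanish by hypothesis and [sigma] fixes [x], so the rule becomes that of
    an ordinary derivation. *)
Lemma delta_block_mul i x y : (forall j, (0 < j < B i)%N -> delta j x = 0) ->
  delta 1 x = 0 -> delta (B i) (x * y) = delta (B i) x * y + x * delta (B i) y.
Proof.
move=> xB x1; rewrite deltaM_ends.
- by rewrite (iter_sigma_fix _ x1).
- by rewrite muln_gt0 n_gt0 expn_gt0 prime_gt0.
move=> j /andP[j0 jB]; rewrite xB ?iter_sigma0 ?mul0r //.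
by rewrite subn_gt0 jB ltn_subrL j0 (leq_trans _ jB).
Qed.

Lemma delta_block_exp i x m : (forall j, (0 < j < B i)%N -> delta j x = 0) ->
  delta 1 x = 0 -> delta (B i) (x ^+ m.+1) = delta (B i) x * x ^+ m *+ m.+1.
Proof.
move=> xB x1; elim: m => [|m IH]; first by rewrite expr1 expr0 mulr1.
by rewrite exprS delta_block_mul // IH mulrnAr mulrCA -exprS -mulrS.
Qed.

Lemma delta1_varX m : (n %| m)%N -> delta 1 (t ^+ m) = 0.
Proof.
rewrite (prim_order_dvd hq) => /eqP qm.
by rewrite delta1 rmorphXn /= sigma_var exprMn -rmorphXn qm rmorph1 mul1r subrr mul0r.
Qed.

(** Kept as a hypothesis at first: its proof for [i] goes through [delta_generated], which needs it
    for all smaller exponents. *)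
Let block_varX i := forall j, (0 < j < B i)%N -> delta j (t ^+ B i) = 0.

(** The power rule for [(t ^ B i) ^ u.+1] produces [u.+1] times [t ^ (B i * u)], which
    [delta (B i * u)] sends to [u.+1]. *)
Let gauss_block i u : block_varX i ->
  gauss (B i * u.+1) (B i * u) = u.+1%:R.
Proof.
move=> Hi; rewrite mulnSr gauss_binom_delta -mulnSr exprM.
rewrite delta_block_exp // ?delta_varX ?mul1r; last by rewrite delta1_varX ?dvdn_mulr.
by rewrite delta_mulrn -exprM delta_varX.
Qed.

(* [j = n * p ^ i * u] with [u] prime to [p], and then
   [delta (j - n * p ^ i) (delta (n * p ^ i) x) = u * delta j x]. *)
Let delta_generated k x : (forall i, (i < k)%N -> block_varX i) -> delta 1 x = 0 ->
  (forall i, (i < k)%N -> delta (B i) x = 0) ->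
  forall j, (0 < j < B k)%N -> delta j x = 0.
Proof.
move=> Hk x1 xB j /andP[j0 jk].
have [/dvdnP[m jm]|/(delta_ndvd x1)//] := boolP (n %| j)%N.
have m0 : (0 < m)%N by move: j0; rewrite jm muln_gt0 => /andP[].
have [u pu mE] := pfactor_coprime p_pr m0.
set i := logn p m in mE.
have ik : (i < k)%N.
  rewrite -(ltn_exp2l _ _ (prime_gt1 p_pr)).
  move: jk; rewrite jm mulnC ltn_pmul2l ?n_gt0 //.
  by apply: leq_ltn_trans; rewrite dvdn_leq // mE dvdn_mull.
case: u pu mE => [|u] pu mE.
  by move: pu; rewrite /coprime gcdn0 => /eqP p1; move: p_pr; rewrite p1.
have jE : j = (B i * u.+1)%N by rewrite jm mE mulnC mulnAC mulnA.
have := delta_delta (B i * u) (B i) x.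
rewrite xB // delta_x0 -mulnSr gauss_block -?jE; last exact: Hk.
move/esym/eqP; rewrite mulf_eq0 => /orP[|/eqP//].
rewrite -(rmorph_nat io) fmorph_eq0 -(dvdn_pcharf hp) => pu1.
by move: pu; rewrite prime_coprime // pu1.
Qed.

(** By [delta_generated] only the indices [B i'] with [i' < i] matter. There [t ^ B i] is a power of
    [t ^ B i'] whose exponent is divisible by [p], so the power rule gives 0. *)
Lemma delta_varX_block i j : (0 < j < B i)%N -> delta j (t ^+ B i) = 0.
Proof.
elim/ltn_ind: i j => i IH j jB.
apply: (@delta_generated i) => // [|i' ii']; first by rewrite delta1_varX ?dvdn_mulr.
rewrite -(subnKC ii') addSnnS expnD mulnA exprM.
have pd : (0 < p ^ (i - i'.+1).+1)%N by rewrite expn_gt0 prime_gt0.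
rewrite -(prednK pd) delta_block_exp ?delta1_varX ?dvdn_mulr //; last exact: IH.
rewrite prednK // expnS mulrnA -[_ *+ p]mulr_natr -(rmorph_nat io).
by rewrite (pcharf0 hp) rmorph0 mulr0 mul0rn.
Qed.

(* [L_k] is the common kernel of the [delta j] with [0 < j < order k]. *)
Definition order k := if k is k'.+1 then (n * p ^ k')%N else 1%N.

Lemma order_gt0 k : (0 < order k)%N.
Proof. by case: k => // k; rewrite muln_gt0 n_gt0 expn_gt0 prime_gt0. Qed.

Lemma ltn_order j : (j < order j.+1)%N.
Proof.
apply: leq_trans (ltn_expl j (prime_gt1 p_pr)) _.
by rewrite leq_pmull.
Qed.

Lemma leq_order k l : (k <= l)%N -> (order k <= order l)%N.
Proof.
case: k l => [|k] [|l] // kl; first exact: order_gt0.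
by rewrite leq_mul2l leq_exp2l ?prime_gt1 // -ltnS kl orbT.
Qed.

(** The kernels defining [L_k] control all indices below [order k] by [delta_generated]; conversely,
    the defining indices are themselves below [order k]. For [k = 0] the range is empty. *)
Lemma LkP k x :
  Lk delta p n k x <-> (forall j, (0 < j < order k)%N -> delta j x = 0).
Proof.
case: k => [|k]; first by split => // _ [].
split=> [[x1 xB]|H].
  by apply: delta_generated => // i _ j; apply: delta_varX_block.
split=> [|j jk]; apply: H => /=.
  by rewrite (leq_trans hn) // leq_pmulr // expn_gt0 prime_gt0.

by rewrite muln_gt0 n_gt0 expn_gt0 prime_gt0 //= ltn_pmul2l // ltn_exp2l ?prime_gt1.
Qed.

(** Only the Leibniz term with [i = 0] survives, and it carries no power of [sigma]. *)
Lemma deltaM_Lk k j a x : (j < order k)%N -> Lk delta p n k x ->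
  delta j (a * x) = delta j a * x.
Proof.
move=> jk /LkP xk; rewrite deltaM big_ord_recl subn0 delta0 big1 ?addr0 // => i _.
by rewrite xk ?mulr0 //= (leq_ltn_trans _ jk).
Qed.

Lemma Lk0 k : Lk delta p n k 0.
Proof. by apply/LkP => j _; rewrite delta_x0. Qed.

Lemma Lk1 k : Lk delta p n k 1.
Proof. by apply/LkP => j /andP[j0 _]; rewrite delta_1. Qed.

Lemma LkN k x : Lk delta p n k x -> Lk delta p n k (- x).
Proof. by move=> /LkP H; apply/LkP => j /H; rewrite deltaN => ->; rewrite oppr0. Qed.

Lemma LkD k x y : Lk delta p n k x -> Lk delta p n k y -> Lk delta p n k (x + y).
Proof.
by move=> /LkP H /LkP K; apply/LkP => j jk; rewrite deltaD H // K // addr0.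
Qed.

Lemma LkM k x y : Lk delta p n k x -> Lk delta p n k y -> Lk delta p n k (x * y).
Proof.
move=> /LkP H K; apply/LkP => j jk.
by rewrite (deltaM_Lk _ _ K) ?H ?mul0r //; case/andP: jk.
Qed.

Lemma Lk_sum k I (r : seq I) F :
  (forall i, Lk delta p n k (F i)) -> Lk delta p n k (\sum_(i <- r) F i).
Proof. by move=> H; elim/big_ind: _ => //; [apply: Lk0|apply: LkD]. Qed.

Lemma Lk_le k l x : (k <= l)%N -> Lk delta p n l x -> Lk delta p n k x.
Proof.
move=> kl /LkP H; apply/LkP => j /andP[j0 jk].
by apply: H; rewrite j0 (leq_trans jk) ?leq_order.
Qed.

(** The carry case of Lucas' theorem. The factor [t ^ order k] of [t ^ (i + j)] lies in [L_k], so
    [delta j] acts on the remaining power of [t], whose exponent is less than [j]. *)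
Lemma gauss_binom_order k i j :
  (i < order k)%N -> (j < order k)%N -> (order k <= i + j)%N -> gauss (i + j) i = 0.
Proof.
case: k => [|k] ik jk ijk; first by case: i ik ijk => //; case: j jk.
rewrite gauss_binom_delta -(subnK ijk) exprD (@deltaM_Lk k.+1) //; last first.
  by apply/LkP => l; apply: delta_varX_block.
by rewrite delta_varX_gt ?mul0r ?delta_x0 // ltn_subLR // ltn_add2r.
Qed.

End IterativeDerivation.

(** * Coordinates in a basis given as a sequence *)

Section BasisCoordinates.
Variables (F : fieldType) (V : vectType F).
Implicit Types (e s : seq V) (v : V).

(** Total on [nat], with value 0 out of range, to match the coefficient families of [ks_basis]. *)
Definition basis_coord e v (i : nat) : F :=
  if insub i is Some i' then coord (in_tuple e) i' v else 0.

Lemma basis_coordE e v : basis_of fullv e ->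
  v = \sum_(i < size e) basis_coord e v i *: e`_i.
Proof.
move=> eB; rewrite [LHS](coord_basis (X := in_tuple e) eB (memvf v)).
by apply: eq_bigr => i _; rewrite /basis_coord insubT //= => ilt; congr (coord _ _ _ *: _); apply: val_inj.
Qed.

Lemma basis_coord_sum e (c : nat -> F) i : basis_of fullv e -> (i < size e)%N ->
  basis_coord e (\sum_(j < size e) c j *: e`_j) i = c i.
Proof.
move=> /basis_free eF ilt; rewrite /basis_coord insubT /=.
exact: (coord_sum_free (fun j : 'I_(size e) => c j) (Ordinal ilt) (X := in_tuple e)) eF.
Qed.

Lemma basis_coord_ge e v i : (size e <= i)%N -> basis_coord e v i = 0.
Proof. by move=> ei; rewrite /basis_coord insubF // ltnNge ei. Qed.

Lemma basis_coordP e a u v i :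
  basis_coord e (a *: u + v) i = a * basis_coord e u i + basis_coord e v i.
Proof.
rewrite /basis_coord; case: insub => [i'|]; last by rewrite mulr0 addr0.
by rewrite linearP.
Qed.

Lemma basis_of_span_free e :
  (forall v, exists c : nat -> F, v = \sum_(i < size e) c i *: e`_i) ->
  (forall c : nat -> F, \sum_(i < size e) c i *: e`_i = 0 -> forall i, (i < size e)%N -> c i = 0) ->
  basis_of fullv e.
Proof.
move=> eS eF; rewrite /basis_of eqEsubv subvf /=; apply/andP; split.
  apply/subvP => v _; have [c ->] := eS v.
  by apply: memv_suml => i _; rewrite memvZ // memv_span // mem_nth.
rewrite -[e]/(tval (in_tuple e)); apply/freeP => k k0 i.
pose c j := if insub j is Some j' then k j' else 0.
have ck (j : 'I_(size e)) : c j = k j by rewrite /c valK.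
by rewrite -ck eF // -[RHS]k0; apply: eq_bigr => j _; rewrite ck.
Qed.

(** The sequences for the vectors of one basis concatenate to a finite spanning sequence in [P];
    dropping each vector that lies in the span of the later ones makes it free. *)
Lemma basis_in_spanning (P : V -> Prop) :
  (forall v, exists s, (forall x, x \in s -> P x) /\ v \in <<s>>%VS) ->
  exists e, basis_of fullv e /\ (forall x, x \in e -> P x).
Proof.
move=> H.
have [s [sP sV]] : exists s, (forall x, x \in s -> P x) /\ (<<s>> = fullv)%VS.
  suff /(_ (vbasis fullv)) [s [sP sV]] : forall r : seq V,
      exists s, (forall x, x \in s -> P x) /\ {subset r <= <<s>>%VS}.
    exists s; split=> //; apply/eqP; rewrite eqEsubv subvf /= -(span_basis (vbasisP fullv)).
    exact/span_subvP.
  elim=> [|x r [s [sP rs]]]; first by exists [::].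
  have [s' [s'P xs']] := H x; exists (s' ++ s); split=> y.
    by rewrite mem_cat => /orP[/s'P|/sP].
  rewrite span_cat inE => /predU1P[->|/rs]; first exact: subvP (addvSl _ _) _ xs'.
  exact: subvP (addvSr _ _) _.
suff [e [eF es eP]] : exists e, [/\ free e, (<<e>> = <<s>>)%VS & forall x, x \in e -> P x].
  by exists e; split=> //; rewrite /basis_of es sV eqxx.
elim: s sP {sV} => [|x s IH] sP; first by exists [::]; split; rewrite ?nil_free.
have [|e [eF es eP]] := IH; first by move=> y ys; apply: sP; rewrite inE ys orbT.
have [xe|xe] := boolP (x \in <<e>>%VS).
  exists e; split=> //; rewrite span_cons -es; apply/esym/addv_idPr.
  by rewrite -memvE.
exists (x :: e); split; first by rewrite free_cons xe.
  by rewrite !span_cons es.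
by move=> y; rewrite inE => /predU1P[->|/eP//]; apply: sP; rewrite inE eqxx.
Qed.
End BasisCoordinates.

(** * From modules to projective systems: the horizontal vectors of each level *)

Section Horizontal.
Variables (C : closedFieldType) (p : nat) (hp : p \in [pchar C]).
Variables (n : nat) (hn : (2 <= n)%N) (q : C) (hq : n.-primitive_root q).
Variables (L : fieldType) (io : {rmorphism C -> L}) (t : L).
Variables (sigma : {rmorphism L -> L}) (delta : nat -> L -> L).
Hypothesis hL : iterative_qdiff_field io q t sigma delta.
Local Notation gauss := (gauss_binom io q).
Local Notation IDM := (IDMobj io q t sigma delta).
Local Notation Lk := (Lk delta p n).
Local Notation order := (order p n).

Section Module.
Variable M : IDM.
Local Notation d := (@idm_delta _ _ _ _ _ _ _ M).
Implicit Types (x y m : idm_space M).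

Lemma idm_delta0 x : d 0 x = x.
Proof. by case: (idm_ax M). Qed.

Lemma idm_deltaD k x y : d k (x + y) = d k x + d k y.
Proof. by case: (idm_ax M) => _ [_ []]. Qed.

Lemma idm_deltaZ k a m :
  d k (a *: m) = \sum_(i < k.+1) iter i sigma (delta (k - i) a) *: d i m.
Proof. by case: (idm_ax M) => _ [_ [_ []]]. Qed.

Lemma idm_delta_delta i j m : d i (d j m) = gauss (i + j) i *: d (i + j) m.
Proof. by case: (idm_ax M) => _ [_ [_ []]]. Qed.

Lemma idm_delta_x0 k : d k 0 = 0.
Proof. by apply: (@addrI _ (d k 0)); rewrite -idm_deltaD !addr0. Qed.

Lemma idm_deltaN k x : d k (- x) = - d k x.
Proof. by apply: (@addrI _ (d k x)); rewrite -idm_deltaD !subrr idm_delta_x0. Qed.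

Lemma idm_delta_sum k I (r : seq I) F :
  d k (\sum_(i <- r) F i) = \sum_(i <- r) d k (F i).
Proof. exact: (big_morph _ (idm_deltaD k) (idm_delta_x0 k)). Qed.

(** Boolean, so that [M_k] can be formed as a subtype inheriting the additive structure. *)
Definition horizontal_pred k : {pred idm_space M} :=
  fun m => all (fun j => d j m == 0) (iota 1 (order k).-1).

Lemma horizontalP k m : reflect (forall j, (0 < j < order k)%N -> d j m = 0)
  (m \in horizontal_pred k).
Proof.
apply: (iffP allP) => H j; rewrite ?mem_iota ?add1n => jk; last first.
  by apply/eqP/H; case: (order k) jk => [|//]; case: j.
by apply/eqP/H; rewrite mem_iota add1n prednK //; case/andP: jk => _; apply: leq_trans.
Qed.

Lemma horizontal_zmod_closed k : zmod_closed (horizontal_pred k).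
Proof.
split=> [|x y xk yk]; apply/horizontalP => j jk; first exact: idm_delta_x0.
by rewrite idm_deltaD idm_deltaN (horizontalP _ _ xk) // (horizontalP _ _ yk) // subr0.
Qed.

HB.instance Definition _ k :=
  GRing.isZmodClosed.Build (idm_space M) (horizontal_pred k) (horizontal_zmod_closed k).

Lemma horizontal_le k l m :
  (k <= l)%N -> m \in horizontal_pred l -> m \in horizontal_pred k.
Proof.
move=> kl /horizontalP H; apply/horizontalP => j /andP[j0 jk].
by apply: H; rewrite j0 (leq_trans jk) ?(leq_order hp hn).
Qed.

Lemma idm_deltaZ_horizontal k j a m : (j < order k)%N -> m \in horizontal_pred k ->
  d j (a *: m) = delta j a *: m.
Proof.
move=> jk /horizontalP xk; rewrite idm_deltaZ big_ord_recl subn0 idm_delta0.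
by rewrite big1 ?addr0 // => i _; rewrite xk ?scaler0 //= (leq_ltn_trans _ jk).
Qed.

Lemma horizontalZ k a m : Lk k a -> m \in horizontal_pred k ->
  a *: m \in horizontal_pred k.
Proof.
move=> /(LkP hp hn hq hL) ak mk; apply/horizontalP => j jk.
by rewrite (idm_deltaZ_horizontal _ _ mk) ?ak ?scale0r //; case/andP: jk.
Qed.

(* If [delta j m] is the top nonzero derivative of [m] below [order k], then it
   is horizontal, and [m - t ^ j *: delta j m] has a lower top derivative. *)
Lemma horizontal_spanning k m : exists s,
  (forall x, x \in s -> x \in horizontal_pred k) /\ m \in <<s>>%VS.
Proof.
suff : forall j, (j <= order k)%N ->
    forall m, (forall i, (j <= i < order k)%N -> d i m = 0) ->
    exists s, (forall x, x \in s -> x \in horizontal_pred k) /\ m \in <<s>>%VS.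
  move/(_ (order k) (leqnn _) m); apply => i /andP[ki ik].
  by move: (leq_trans ik ki); rewrite ltnn.
elim=> [_|j IH jk] {}m mj.
  exists [::]; split=> //.
  by rewrite -[m]idm_delta0 mj ?mem0v // (order_gt0 hp hn).
pose m0 := d j m.
have m0k : m0 \in horizontal_pred k.
  apply/horizontalP => i /andP[i0 ik]; rewrite idm_delta_delta.
  (* Below [order k] the choice of [j] kills [d (i + j) m]; from [order k] on the binomial
     vanishes. *)
  have [ijk|ijk] := ltnP (i + j) (order k).
    by rewrite mj ?scaler0 // ijk andbT -add1n leq_add2r.
  by rewrite (gauss_binom_order hp hn hq hL ik jk ijk) scale0r.
have [||s [sP ms]] := IH _ (m - t ^+ j *: m0); first exact: ltnW.
  move=> i /andP[ji ik]; rewrite idm_deltaD idm_deltaN (idm_deltaZ_horizontal _ ik m0k).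
  case: ltngtP ji => // [ji|<-] _.
    by rewrite (delta_varX_gt hn hq hL) // mj ?ji // scale0r subr0.
  by rewrite (delta_varX hn hq hL) scale1r subrr.
exists (m0 :: s); split=> [x|]; first by rewrite inE => /predU1P[->|/sP].
rewrite -(subrK (t ^+ j *: m0) m) span_cons addrC memv_add //.
by rewrite memvZ // memv_line.
Qed.

Lemma horizontal_basis k : exists e, basis_of fullv e /\
  (forall x, x \in e -> x \in horizontal_pred k).
Proof. exact: basis_in_spanning (horizontal_spanning k). Qed.

(** In the basis [e] the coordinates of [d j m = 0] are the [delta j] of the coordinates of [m]. *)
Lemma horizontal_basis_coord k (e : seq (idm_space M)) m i : basis_of fullv e ->
  (forall x, x \in e -> x \in horizontal_pred k) ->
  m \in horizontal_pred k -> Lk k (basis_coord e m i).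
Proof.
move=> eB ek /horizontalP mk; apply/(LkP hp hn hq hL) => j jk.
have [ei|ie] := leqP (size e) i; first by rewrite basis_coord_ge // (delta_x0 hL).
pose c i := delta j (basis_coord e m i).
rewrite -/(c i) -(basis_coord_sum c eB ie).
suff -> : \sum_(l < size e) c l *: e`_l = 0.
  by rewrite /basis_coord; case: insub => // i'; rewrite linear0.
rewrite -[RHS](mk j jk) [in RHS](basis_coordE m eB) idm_delta_sum.
apply: eq_bigr => l _; rewrite (@idm_deltaZ_horizontal k) //; first by case/andP: jk.
by rewrite ek // mem_nth.
Qed.

Record horizontal k := Horizontal {
  horizontal_val :> idm_space M;
  horizontal_valP : horizontal_val \in horizontal_pred k }.

HB.instance Definition _ k := [isSub for @horizontal_val k].
HB.instance Definition _ k := [Choice of horizontal k by <:].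
HB.instance Definition _ k := [SubChoice_isSubZmodule of horizontal k by <:].

Lemma horizontal_valD k (u v : horizontal k) : val (u + v) = val u + val v.
Proof. exact: raddfD. Qed.

(** [KSpace] asks for an operation of all of [L]; when the product leaves [M_k] the default value is
    [u]. *)
Definition horizontal_scale k (a : L) (u : horizontal k) : horizontal k :=
  insubd u (a *: val u).

Lemma val_horizontal_scale k a (u : horizontal k) : Lk k a ->
  val (horizontal_scale a u) = a *: val u.
Proof. by move=> ak; rewrite /horizontal_scale insubdK // horizontalZ //; case: u. Qed.

Lemma horizontal_scaleDr k a (u v : horizontal k) : Lk k a ->
  horizontal_scale a (u + v) = horizontal_scale a u + horizontal_scale a v.
Proof. by move=> ak; apply: val_inj; rewrite horizontal_valD !val_horizontal_scale // horizontal_valD scalerDr. Qed.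

Lemma horizontal_scaleDl k a b (u : horizontal k) : Lk k a -> Lk k b ->
  horizontal_scale (a + b) u = horizontal_scale a u + horizontal_scale b u.
Proof.
move=> ak bk; apply: val_inj; rewrite horizontal_valD !val_horizontal_scale ?scalerDl //.
exact: (LkD hp hn hq hL).
Qed.

Lemma horizontal_scaleA k a b (u : horizontal k) : Lk k a -> Lk k b ->
  horizontal_scale (a * b) u = horizontal_scale a (horizontal_scale b u).
Proof.
move=> ak bk; apply: val_inj; rewrite !val_horizontal_scale ?scalerA //.
exact: (LkM hp hn hq hL).
Qed.

Lemma horizontal_scale1 k (u : horizontal k) : horizontal_scale 1 u = u.
Proof. by apply: val_inj; rewrite val_horizontal_scale ?scale1r //; apply: (Lk1 hp hn hq hL). Qed.

Definition to_horizontal k (m : idm_space M) : horizontal k := insubd 0 m.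

Lemma val_to_horizontal k m : m \in horizontal_pred k -> val (to_horizontal k m) = m.
Proof. by move=> mk; rewrite /to_horizontal insubdK. Qed.

(** Spanning comes from [horizontal_basis_coord]; freeness over [L_k] is inherited from freeness
    over [L]. *)
Lemma horizontal_ks_basis k (e : seq (idm_space M)) : basis_of fullv e ->
  (forall x, x \in e -> x \in horizontal_pred k) ->
  ks_basis (Lk k) (@horizontal_scale k) (map (to_horizontal k) e).
Proof.
move=> eB ek.
have valE (c : nat -> L) : (forall i, Lk k (c i)) ->
    val (\sum_(i < size e) horizontal_scale (c i) (map (to_horizontal k) e)`_i) =
    \sum_(i < size e) c i *: e`_i.
  move=> ck; rewrite raddf_sum; apply: eq_bigr => i _.
  apply: etrans (val_horizontal_scale _ (ck i)) _.
  by rewrite (nth_map 0) // val_to_horizontal // ek // mem_nth.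
rewrite /ks_basis size_map; split=> [v|c ck c0 i ie].
  have ck i : Lk k (basis_coord e (val v) i).
    by apply: horizontal_basis_coord => //; case: v.
  by exists (basis_coord e (val v)); split=> //; apply: val_inj; rewrite valE // -basis_coordE.
rewrite -(basis_coord_sum c eB ie) -valE // c0 raddf0.
by rewrite /basis_coord; case: insub => // i'; rewrite linear0.
Qed.

Definition horizontal_space k : KSpace (Lk k).
Proof.
exists (horizontal k) (@horizontal_scale k).
- exact: horizontal_scaleDr.
- exact: horizontal_scaleDl.
- exact: horizontal_scaleA.
- exact: horizontal_scale1.
- have [e [eB ek]] := horizontal_basis k.
  by exists (map (to_horizontal k) e); apply: horizontal_ks_basis.
Defined.

Definition horizontal_incl k (u : horizontal k.+1) : horizontal k :=
  Horizontal (horizontal_le (leqnSn k) (horizontal_valP u)).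

Definition horizontal_system : ProjObj delta p n.
Proof.
exists horizontal_space horizontal_incl => k.
- move=> a x y ak; apply: val_inj; rewrite [RHS]horizontal_valD [in RHS]val_horizontal_scale.
    by apply: etrans (horizontal_valD _ _) _; rewrite val_horizontal_scale.
  exact: (Lk_le hp hn hq hL (leqnSn k)).
(* A single [L]-basis of [M] inside [M_{k+1}] serves at both levels. *)
- have [e [eB ek]] := horizontal_basis k.+1.
  exists (map (to_horizontal k.+1) e); split; first exact: horizontal_ks_basis.
  have -> : map (@horizontal_incl k) (map (to_horizontal k.+1) e) = map (to_horizontal k) e.
    rewrite -map_comp; apply/eq_in_map => x /ek xk; apply: val_inj => /=.
    by rewrite val_to_horizontal // val_to_horizontal // (horizontal_le (leqnSn k)).
  apply: horizontal_ks_basis => // x /ek; exact: horizontal_le.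
Defined.

End Module.

Arguments horizontal_pred : clear implicits.
Arguments horizontal : clear implicits.

(** * Action on morphisms *)

Section Functor.
Variables (M N : IDM) (f : IDMhom M N).

Lemma IDMhomD x y : sval f (x + y) = sval f x + sval f y.
Proof. by have := (proj2_sig f).1 1 x y; rewrite !scale1r. Qed.

Lemma IDMhom0 : sval f 0 = 0.
Proof. by apply: (@addrI _ (sval f 0)); rewrite -IDMhomD !addr0. Qed.

Lemma IDMhomZ a x : sval f (a *: x) = a *: sval f x.
Proof. by have := (proj2_sig f).1 a x 0; rewrite IDMhom0 !addr0. Qed.

Lemma IDMhom_horizontal k x : x \in horizontal_pred M k -> sval f x \in horizontal_pred N k.
Proof.
move=> /horizontalP xk; apply/horizontalP => j jk.
by rewrite -(proj2_sig f).2 xk // IDMhom0.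
Qed.

Definition horizontal_map k (u : horizontal M k) : horizontal N k :=
  Horizontal (IDMhom_horizontal (horizontal_valP u)).

Lemma horizontal_map_hom :
  @Projhom_prop _ delta p n (horizontal_system M) (horizontal_system N) horizontal_map.
Proof.
split=> [k a x y ak|k x]; apply: val_inj => //.
rewrite [RHS]horizontal_valD [in RHS]val_horizontal_scale //.
rewrite -[LHS]/(sval f (val (_ + _))) horizontal_valD val_horizontal_scale //.
by rewrite IDMhomD IDMhomZ.
Qed.

Definition horizontal_hom : Projhom (horizontal_system M) (horizontal_system N) :=
  exist _ _ horizontal_map_hom.
End Functor.

Lemma Projhom_eq (M N : ProjObj delta p n) (f g : Projhom M N) :
  (forall k x, sval f k x = sval g k x) -> f = g.
Proof.
move=> fg; apply: eq_sig_hprop => [*|]; first exact: Prop_irrelevance.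
apply: functional_extensionality_dep => k.
by apply/funext => x; apply: fg.
Qed.

Lemma IDMhom_eq (M N : IDM) (f g : IDMhom M N) :
  (forall x, sval f x = sval g x) -> f = g.
Proof.
move=> fg; apply: eq_sig_hprop => [*|]; first exact: Prop_irrelevance.
by apply/funext => x; apply: fg.
Qed.

Definition horizontal_functor :
  Functor (IDMCat io q t sigma delta) (ProjCat delta p n).
Proof.
exists horizontal_system (@horizontal_hom).
- by move=> M; apply: Projhom_eq => k x; apply: val_inj.
- by move=> M N P g f; apply: Projhom_eq => k x; apply: val_inj.
Defined.

End Horizontal.

Arguments horizontal_pred {C} p n {q L io t sigma delta} M k _.

(** * From projective systems to modules: derivations on the bottom space *)

Section Descent.
Variables (C : closedFieldType) (p : nat) (hp : p \in [pchar C]).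
Variables (n : nat) (hn : (2 <= n)%N) (q : C) (hq : n.-primitive_root q).
Variables (L : fieldType) (io : {rmorphism C -> L}) (t : L).
Variables (sigma : {rmorphism L -> L}) (delta : nat -> L -> L).
Hypothesis hL : iterative_qdiff_field io q t sigma delta.
Local Notation Lk := (Lk delta p n).
Local Notation order := (order p n).

Section Object.
Variable N : ProjObj delta p n.
Local Notation Nk k := (ks_car (pN N k)).

(** As [L_0] is all of [L], the [KSpace] laws hold without restriction here; the alias carries the
    resulting [vectType] structure. *)
Definition bottom : Type := Nk 0.

HB.instance Definition _ := GRing.Zmodule.on bottom.

Let bottom_scaleA (a b : L) (v : bottom) :
  @ks_scale _ _ (pN N 0) a (ks_scale b v) = ks_scale (a * b) v.
Proof. by rewrite ks_scaleA. Qed.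
Let bottom_scale1 : left_id 1 (@ks_scale _ _ (pN N 0)).
Proof. exact: ks_scale1. Qed.
Let bottom_scaleDr : right_distributive (@ks_scale _ _ (pN N 0)) +%R.
Proof. by move=> a u v; apply: ks_scaleDr. Qed.
Let bottom_scaleDl (v : bottom) : {morph (@ks_scale _ _ (pN N 0))^~ v : a b / a + b}.
Proof. by move=> a b; apply: ks_scaleDl. Qed.

HB.instance Definition _ := GRing.Zmodule_isLmodule.Build L bottom
  bottom_scaleA bottom_scale1 bottom_scaleDr bottom_scaleDl.

Lemma bottom_vector_axiom :
  {d : nat & Vector.axiom d bottom}.
Proof.
(* The goal is a sigma type, so the basis and its coordinate functions have to be chosen. *)
have [e [eS eF]] := cid (ks_findim (pN N 0)).
have [c cE] := choice eS.
have cS (v : bottom) : v = \sum_(i < size e) c v i *: (e`_i : bottom) := (cE v).2.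
have uniq_c (v : bottom) (a : nat -> L) : v = \sum_(i < size e) a i *: (e`_i : bottom) ->
    forall i, (i < size e)%N -> c v i = a i.
  move=> vE i ie; apply/eqP; rewrite -subr_eq0; apply/eqP.
  apply: (eF (fun i => c v i - a i)) => //.
  transitivity (v - v); last exact: subrr.
  rewrite [X in X - _]cS [X in _ - X]vE -sumrB; apply: eq_bigr => j _.
  exact: (scalerBl (c v j) (a j) (e`_j : bottom)).
exists (size e), (fun v => \row_i c v i).
  move=> a u v; apply/rowP => i; rewrite !mxE.
  apply: (uniq_c _ (fun i => a * c u i + c v i)) => //.
  rewrite {1}(cS u) {1}(cS v) scaler_sumr -big_split.
  by apply: eq_bigr => j _; rewrite scalerDl scalerA.
exists (fun r : 'rV_(size e) => \sum_i r 0 i *: (e`_i : bottom)) => [v|r].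
  by rewrite [RHS]cS; apply: eq_bigr => i _; rewrite mxE.
apply/rowP => i; rewrite mxE.
pose a j := if insub j is Some j' then r 0 j' else 0.
have aE (j : 'I_(size e)) : a j = r 0 j by rewrite /a valK.
by rewrite (uniq_c _ a) ?aE //; apply: eq_bigr => j _; rewrite aE.
Qed.

HB.instance Definition _ :=
  Lmodule_hasFinDim.Build L bottom (projT2 bottom_vector_axiom).

Fixpoint to_bottom k : Nk k -> bottom :=
  if k is k'.+1 then fun x => to_bottom (@pPsi _ _ _ _ N k' x) else id.

Lemma to_bottom_lin k a x y : Lk k a ->
  to_bottom (@ks_scale _ _ (pN N k) a x + y) = a *: to_bottom x + to_bottom y.
Proof.
elim: k x y => [|k IH] x y ak //=.
by rewrite pPsi_lin // IH //; apply: (Lk_le hp hn hq hL (leqnSn k)).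
Qed.

Lemma to_bottomD k (x y : Nk k) : to_bottom (x + y) = to_bottom x + to_bottom y.
Proof.
have := to_bottom_lin x y (Lk1 hp hn hq hL k).
by rewrite ks_scale1 scale1r.
Qed.

Lemma to_bottom0 k : to_bottom (0 : Nk k) = 0.
Proof. by apply: (@addrI _ (to_bottom (0 : Nk k))); rewrite -to_bottomD !addr0. Qed.

Lemma to_bottomZ k a (x : Nk k) : Lk k a ->
  to_bottom (ks_scale a x) = a *: to_bottom x.
Proof. by move=> ak; rewrite -[ks_scale a x]addr0 to_bottom_lin // to_bottom0 addr0. Qed.

Lemma to_bottomN k (x : Nk k) : to_bottom (- x) = - to_bottom x.
Proof. by apply: (@addrI _ (to_bottom x)); rewrite -to_bottomD !subrr to_bottom0. Qed.

Lemma to_bottom_sum k (e : seq (Nk k)) (c : nat -> L) : (forall i, Lk k (c i)) ->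
  to_bottom (\sum_(i < size e) ks_scale (c i) e`_i) =
  \sum_(i < size e) c i *: (map (@to_bottom k) e)`_i.
Proof.
move=> ck; rewrite (big_morph _ (@to_bottomD k) (to_bottom0 k)).
by apply: eq_bigr => i _; rewrite to_bottomZ // (nth_map 0).
Qed.

Definition in_level k (v : bottom) := exists x : Nk k, to_bottom x = v.

Lemma in_level_le k l v : (k <= l)%N -> in_level l v -> in_level k v.
Proof.
move/subnKC <-; elim: (l - k)%N v => [|m IH] v; first by rewrite addn0.
by rewrite addnS => -[x <-]; apply: IH; exists (pPsi x).
Qed.

Definition level_span k (e : seq bottom) (v : bottom) :=
  exists c : nat -> L, (forall i, Lk k (c i)) /\ v = \sum_(i < size e) c i *: e`_i.

(** Such an [e] is at once an [L_k]-basis of the image of every [N_k] with [k <= K], freeness being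
    inherited from [L]. *)
Definition adapted K (e : seq bottom) :=
  basis_of fullv e /\
  forall k, (k <= K)%N -> forall v, in_level k v <-> level_span k e v.

Lemma adapted_coord K e k v i : adapted K e -> (k <= K)%N -> in_level k v ->
  Lk k (basis_coord e v i).
Proof.
move=> [eB eK] kK /(eK k kK) [c [ck ->]].
have [ei|ie] := leqP (size e) i; last by rewrite basis_coord_sum.
by rewrite basis_coord_ge //; apply: (Lk0 hp hn hq hL).
Qed.

Lemma adapted_nth K e k i : adapted K e -> (k <= K)%N -> in_level k e`_i.
Proof.
move=> [eB eK] kK; apply/(eK k kK).
have [ei|ie] := leqP (size e) i.
  exists (fun=> 0); split=> [_|]; first exact: (Lk0 hp hn hq hL).
  by rewrite nth_default // big1 // => j _; rewrite scale0r.
exists (fun j => (j == i)%:R); split=> [j|].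
  by case: (j == i); [apply: (Lk1 hp hn hq hL)|apply: (Lk0 hp hn hq hL)].
rewrite (bigD1 (Ordinal ie)) //= eqxx scale1r big1 ?addr0 // => j ji.
by rewrite (_ : (_ == _) = false) ?scale0r //; apply/negbTE.
Qed.

(* [f] and [e] are two [L_K]-bases of the image of [N_K]; the transition
   matrices [A] and [B] between them have entries in [L_K] and [A B = 1]. *)
Lemma adapted_exists K :
  (exists e, adapted K e) /\ (forall x : Nk K, to_bottom x = 0 -> x = 0).
Proof.
elim: K => [|K [[e eK] injK]].
  split=> //; have [e [eS eF]] := ks_findim (pN N 0).
  have eB : basis_of (fullv : {vspace bottom}) e.
    apply: basis_of_span_free => [v|c c0 i ie]; last exact: (eF c).
    by have [c [_ ->]] := eS v; exists c.
  exists e; split=> // k; rewrite leqn0 => /eqP-> v; split=> [_|_]; last by exists v.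
  by exists (basis_coord (e : seq bottom) v); split=> //; apply: basis_coordE.
have [e' [[e'S e'F] [gS gF]]] := pPsi_ext N K.
pose f := map (@to_bottom K.+1) e'.
have fE : f = map (@to_bottom K) (map (@pPsi _ _ _ _ N K) e') by rewrite -map_comp.
have sf : size f = size e' by rewrite size_map.
(* Freeness over [L_K] holds in [N_K]; injectivity at level [K] carries it to the bottom space. *)
have f_uniq (c : nat -> L) : (forall i, Lk K (c i)) ->
    \sum_(l < size f) c l *: f`_l = 0 -> forall l, (l < size f)%N -> c l = 0.
  move=> cK c0 l lf; apply: (gF c cK); last by rewrite size_map -sf.
  apply: injK; rewrite to_bottom_sum // -[RHS]c0 size_map -sf.
  by apply: eq_bigr => i _; rewrite -fE.
pose A j i := basis_coord e f`_j i.
have f_level j : in_level K f`_j.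
  have [jf|fj] := ltnP j (size e'); last first.
    by rewrite nth_default ?sf //; exists 0; apply: to_bottom0.
  by rewrite (nth_map 0) //; exists (pPsi e'`_j).
have AK j i : Lk K (A j i) by apply: (adapted_coord _ eK).
have fA j : f`_j = \sum_(i < size e) A j i *: e`_i by apply: basis_coordE; case: eK.
have /choice[B BP] : forall i : nat, exists b : nat -> L, (forall j, Lk K (b j)) /\
    e`_i = \sum_(j < size f) b j *: f`_j.
  move=> i.
  have [x xE] := adapted_nth i eK (leqnn K).
  have [b [bK xb]] := gS x; exists b; split=> //.
  rewrite -xE xb to_bottom_sum // size_map -sf.
  by apply: eq_bigr => j _; rewrite -fE.
(* Out of range the [j]-th entry of [f] is 0, hence so is row [j] of the product; this accounts for
   the truncation. *)
have AB j l : (l < size f)%N -> \sum_(i < size e) A j i * B i l = (l == j)%:R *+ (j < size f)%N.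
  move=> lf; apply/eqP; rewrite -subr_eq0; apply/eqP.
  apply: (f_uniq (fun l => \sum_(i < size e) A j i * B i l - (l == j)%:R *+ (j < size f)%N)) => // [i|].
    apply: (LkD hp hn hq hL).
      by apply: (Lk_sum hp hn hq hL) => r; apply: (LkM hp hn hq hL) => //; apply: (BP r).1.
    apply: (LkN hp hn hq hL); case: (_ == _); case: (_ < _)%N;
      by [apply: (Lk1 hp hn hq hL)|apply: (Lk0 hp hn hq hL)].
  under eq_bigr do rewrite scalerBl scaler_suml.
  rewrite sumrB exchange_big /=.
  apply/eqP; rewrite subr_eq0; apply/eqP; transitivity f`_j.
    rewrite [RHS]fA; apply: eq_bigr => i _; rewrite (BP i).2 scaler_sumr.
    by apply: eq_bigr => r _; rewrite scalerA.
  have [jf|fj] := ltnP j (size f); last first.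
    by rewrite nth_default // big1 // => r _; rewrite mulr0n scale0r.
  rewrite (bigD1 (Ordinal jf)) //= eqxx scale1r big1 ?addr0 // => r rj.
  by rewrite (_ : (_ == _) = false) ?scale0r //; apply/negbTE.
have e_to_f (c : nat -> L) : \sum_(i < size e) c i *: e`_i =
    \sum_(j < size f) (\sum_(i < size e) c i * B i j) *: f`_j.
  under [RHS]eq_bigr do rewrite scaler_suml.
  rewrite [RHS]exchange_big /=; apply: eq_bigr => i _; rewrite {1}(BP i).2 scaler_sumr.
  by apply: eq_bigr => j _; rewrite scalerA.
have f_to_e (c : nat -> L) : \sum_(j < size f) c j *: f`_j =
    \sum_(i < size e) (\sum_(j < size f) c j * A j i) *: e`_i.
  under [RHS]eq_bigr do rewrite scaler_suml.
  rewrite [RHS]exchange_big /=; apply: eq_bigr => j _; rewrite {1}fA scaler_sumr.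
  by apply: eq_bigr => i _; rewrite scalerA.
have fB : basis_of fullv f.
  apply: basis_of_span_free => [v|c c0 l lf].
    rewrite (basis_coordE v eK.1) e_to_f.
    by exists (fun j => \sum_(i < size e) basis_coord e v i * B i j).
  (* A relation [c] on [f] gives [c A = 0] because [e] is a basis, and then [c = c A B = 0]. *)
  have cA i : (i < size e)%N -> \sum_(j < size f) c j * A j i = 0.
    move=> ie; have := basis_coord_sum (fun i => \sum_(j < size f) c j * A j i) eK.1 ie.
    rewrite -f_to_e c0 => <-.
    by rewrite /basis_coord; case: insub => // i'; rewrite linear0.
  have : \sum_(i < size e) (\sum_(j < size f) c j * A j i) * B i l = c l.
    transitivity (\sum_(j < size f) c j * (l == j)%:R).
      under eq_bigr do rewrite mulr_suml.
      rewrite exchange_big /=; apply: eq_bigr => j _.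
      have := AB j l lf; rewrite ltn_ord mulr1n => <-; rewrite mulr_sumr.
      by apply: eq_bigr => i _; rewrite mulrA.
    rewrite (bigD1 (Ordinal lf)) //= eqxx mulr1 big1 ?addr0 // => j jl.
    by rewrite eq_sym (_ : (_ == _) = false) ?mulr0 //; apply/negbTE.
  by move=> <-; rewrite big1 // => i _; rewrite cA // mul0r.
(* Injectivity one level up: the coefficients of [x] in [e'] are the coordinates of [to_bottom x] in
   [f]. *)
split=> [|x x0]; last first.
  have [c [cK xc]] := e'S x; rewrite xc big1 // => i _.
  suff -> : c i = 0.
    apply: (@addrI _ (ks_scale 0 e'`_i)); rewrite -ks_scaleDl ?addr0 //; exact: (Lk0 hp hn hq hL).
  have if_ : (i < size f)%N by rewrite sf.
  rewrite -(basis_coord_sum c fB if_) sf -to_bottom_sum // -xc x0.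
  by rewrite /basis_coord; case: insub => // i'; rewrite linear0.
exists f; split=> // k; rewrite leq_eqVlt => /predU1P[->|kK] v.
  split=> [[x <-]|[c [cK ->]]].
    have [c [cK ->]] := e'S x; exists c; split=> //.
    by rewrite to_bottom_sum // sf.
  exists (\sum_(i < size e') ks_scale (c i) e'`_i).
  by rewrite to_bottom_sum // sf.
rewrite ltnS in kK; split=> [/(eK.2 k kK) [c [ck ->]]|[c [ck ->]]].
  rewrite e_to_f; exists (fun j => \sum_(i < size e) c i * B i j); split=> // j.
  apply: (Lk_sum hp hn hq hL) => i; apply: (LkM hp hn hq hL) => //.
  exact: (Lk_le hp hn hq hL kK ((BP i).1 j)).
apply/(eK.2 k kK); rewrite f_to_e; exists (fun i => \sum_(j < size f) c j * A j i).
split=> // i; apply: (Lk_sum hp hn hq hL) => j; apply: (LkM hp hn hq hL) => //.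
exact: (Lk_le hp hn hq hL kK).
Qed.

Lemma to_bottom_inj k : injective (@to_bottom k).
Proof.
move=> x y xy; apply/eqP; rewrite -subr_eq0; apply/eqP/(adapted_exists k).2.
by rewrite to_bottomD to_bottomN xy subrr.
Qed.

Definition adapted_basis K : seq bottom := sval (cid (adapted_exists K).1).

Lemma adapted_basisP K : adapted K (adapted_basis K).
Proof. by rewrite /adapted_basis; case: cid. Qed.

(** Level [j.+1] is deep enough since [j < order j.+1]. *)
Definition bottom_delta j (v : bottom) : bottom :=
  let e := adapted_basis j.+1 in
  \sum_(i < size e) delta j (basis_coord e v i) *: e`_i.

Lemma bottom_deltaD j (u v : bottom) :
  bottom_delta j (u + v) = bottom_delta j u + bottom_delta j v.
Proof.
rewrite /bottom_delta -big_split; apply: eq_bigr => i _ /=.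
by rewrite -[u]scale1r basis_coordP mul1r scale1r (deltaD hL) scalerDl.
Qed.

Lemma bottom_delta0 j : bottom_delta j 0 = 0.
Proof. by apply: (@addrI _ (bottom_delta j 0)); rewrite -bottom_deltaD !addr0. Qed.

(** This shows independence of the level. With [l] the smaller of [k] and [j.+1], the coordinates of
    [v] lie in [L_l] and [j < order l], so [delta j] passes over them. *)
Lemma bottom_deltaZ_level k j a (v : bottom) : (j < order k)%N -> in_level k v ->
  bottom_delta j (a *: v) = delta j a *: v.
Proof.
move=> jk kv; pose l := minn k j.+1.
have jl : (j < order l)%N by rewrite /l /minn; case: ifP => // _; apply: (ltn_order hp hn).
have lv : in_level l v by apply: in_level_le kv; apply: geq_minl.
have eP := adapted_basisP j.+1; rewrite [in RHS](basis_coordE v eP.1) scaler_sumr.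
apply: eq_bigr => i _; rewrite -[a *: v]addr0 basis_coordP.
rewrite [X in _ + X](_ : _ = 0) ?addr0; last first.
  by rewrite /basis_coord; case: insub => // i'; rewrite linear0.
rewrite (deltaM_Lk hp hn hq hL _ jl) ?scalerA //.
exact: (adapted_coord _ eP (geq_minr _ _) lv).
Qed.

(** Reduces identities additive in [v] to multiples of vectors of a level chosen so deep that
    [bottom_delta] acts on the coefficient alone. *)
Lemma bottom_level_ind K (P : bottom -> Prop) : P 0 ->
  (forall u v, P u -> P v -> P (u + v)) ->
  (forall a v, in_level K v -> P (a *: v)) -> forall v, P v.
Proof.
move=> P0 PD PZ v; have eP := adapted_basisP K.
rewrite (basis_coordE v eP.1); elim/big_ind: _ => // i _.
by apply: PZ; apply: adapted_nth eP _.
Qed.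

Lemma bottom_sigma_bij :
  bijective (fun v : bottom => ((io q - 1) * t) *: bottom_delta 1 v + v).
Proof.
have [s' s'K sK'] : bijective sigma by case: hL => _ [].
(* [bottom_delta 1] is computed in the adapted basis of index 2, where the map is [sigma] on
   coordinates. *)
have eP := adapted_basisP 2; set e := adapted_basis 2 in eP.
pose phi (v : bottom) := ((io q - 1) * t) *: bottom_delta 1 v + v.
have phiE v : phi v = \sum_(i < size e) sigma (basis_coord e v i) *: e`_i.
  rewrite /phi {2}(basis_coordE v eP.1) scaler_sumr -big_split; apply: eq_bigr => i _ /=.
  by rewrite scalerA -scalerDl -(sigma_delta1 hn hq hL).
exists (fun v => \sum_(i < size e) s' (basis_coord e v i) *: e`_i) => v.
  rewrite -/(phi v) [RHS](basis_coordE v eP.1); apply: eq_bigr => i _.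
  by rewrite phiE (basis_coord_sum (fun i => sigma (basis_coord e v i))) ?eP.1 // s'K.
rewrite -/(phi _) phiE [RHS](basis_coordE v eP.1); apply: eq_bigr => i _.
by rewrite (basis_coord_sum (fun i => s' (basis_coord e v i))) ?eP.1 // sK'.
Qed.

Lemma bottom_is_IDM : @is_IDM _ _ io q t sigma delta bottom bottom_delta.
Proof.
split=> [v|].
  by rewrite -[v]scale1r (@bottom_deltaZ_level 0) ?(delta0 hL) //; exists v.
split; first exact: bottom_sigma_bij.
split; first exact: bottom_deltaD.
split=> [k a v|i j v].
  elim/(@bottom_level_ind k.+1): v => [|u v IHu IHv|b v kv].
  - by rewrite scaler0 bottom_delta0 big1 // => i _; rewrite bottom_delta0 scaler0.
  - rewrite scalerDr bottom_deltaD IHu IHv -big_split; apply: eq_bigr => i _ /=.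
    by rewrite bottom_deltaD scalerDr.
  rewrite scalerA (bottom_deltaZ_level _ (ltn_order hp hn k)) // (deltaM hL) scaler_suml.
  apply: eq_bigr => i _; rewrite (@bottom_deltaZ_level k.+1) ?scalerA //.
  by apply: leq_ltn_trans (ltn_order hp hn k); rewrite -ltnS.
(* Level [(i + j).+1] serves the three derivatives of orders [i], [j] and [i + j] at once. *)
elim/(@bottom_level_ind (i + j).+1): v => [|u v IHu IHv|a v kv].
- by rewrite !bottom_delta0 scaler0.
- by rewrite !bottom_deltaD IHu IHv scalerDr.
have lt_order l : (l <= i + j)%N -> (l < order (i + j).+1)%N.
  by move=> lij; apply: leq_ltn_trans lij (ltn_order hp hn _).
rewrite !(@bottom_deltaZ_level (i + j).+1) ?lt_order ?leq_addr ?leq_addl //.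
by rewrite (delta_delta hL) scalerA.
Qed.

Definition bottom_IDM : IDMobj io q t sigma delta := MkIDM bottom_is_IDM.

(** Recovers [N_k] from the descended module. One direction is [delta j 1 = 0]; for the other, the
    coordinates in an adapted basis are killed by [delta j], hence lie in [L_k]. *)
Lemma in_level_horizontal k (v : bottom) :
  in_level k v <-> v \in horizontal_pred p n bottom_IDM k.
Proof.
split=> [kv|/horizontalP vk].
  apply/horizontalP => j /andP[j0 jk]; rewrite -[v]scale1r.
  by rewrite [LHS](bottom_deltaZ_level _ jk kv) (delta_1 hL) // scale0r.
have eP := adapted_basisP k; set e := adapted_basis k in eP.
apply/(eP.2 k (leqnn k)); exists (basis_coord e v); split; last exact: basis_coordE eP.1.
move=> i; apply/(LkP hp hn hq hL) => j /andP[j0 jk].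
have [ei|ie] := leqP (size e) i; first by rewrite basis_coord_ge // (delta_x0 hL).
rewrite -(basis_coord_sum (fun i => delta j (basis_coord e v i)) eP.1 ie) /=.
suff -> : \sum_(l < size e) delta j (basis_coord e v l) *: e`_l = 0.
  by rewrite /basis_coord; case: insub => // i'; rewrite linear0.
rewrite -[RHS](vk j); last by rewrite j0.
rewrite [in RHS](basis_coordE v eP.1) /=.
rewrite (big_morph _ (bottom_deltaD j) (bottom_delta0 j)); apply: eq_bigr => l _.
by rewrite (bottom_deltaZ_level _ jk) //; apply: adapted_nth eP _.
Qed.

End Object.

Section Morphism.
Variables (M N : ProjObj delta p n) (f : Projhom M N).

Lemma Projhom_to_bottom k x : sval f 0 (to_bottom x) = to_bottom (sval f k x).
Proof. by elim: k x => //= k IH x; rewrite IH (proj2_sig f).2. Qed.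

Lemma bottom_hom_prop :
  @IDMhom_prop _ _ io q t sigma delta (bottom_IDM M) (bottom_IDM N) (sval f 0).
Proof.
have lin (a : L) (x y : bottom M) :
    sval f 0 (a *: x + y) = a *: (sval f 0 x : bottom N) + sval f 0 y.
  exact: ((proj2_sig f).1 0).
have f0 : sval f 0 (0 : bottom M) = 0 :> bottom N.
  have := lin 1 0 0; rewrite !scale1r addr0 => f0.
  by apply: (@addrI _ (sval f 0 (0 : bottom M) : bottom N)); rewrite addr0 -f0.
split=> [//|k x] /=.
(* The map preserves level [k.+1], so on multiples of such vectors the derivation acts on the
   coefficient on both sides. *)
elim/(@bottom_level_ind M k.+1): x => [|u v IHu IHv|a v [x xv]].
- by rewrite bottom_delta0 f0 bottom_delta0.
- have fD (x y : bottom M) : sval f 0 (x + y) = sval f 0 x + sval f 0 y :> bottom N.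
    by rewrite -[x]scale1r lin !scale1r.
  by rewrite bottom_deltaD !fD bottom_deltaD IHu IHv.
have fZ b : sval f 0 (b *: v) = b *: (sval f 0 v : bottom N).
  by rewrite -[b *: v]addr0 lin f0 addr0.
have kk := ltn_order hp hn k.
rewrite (bottom_deltaZ_level _ kk) ?fZ; last by exists x.
rewrite (bottom_deltaZ_level _ kk) //.
by exists (sval f k.+1 x); rewrite -Projhom_to_bottom xv.
Qed.

Definition bottom_hom : IDMhom (bottom_IDM M) (bottom_IDM N) :=
  exist _ _ bottom_hom_prop.
End Morphism.

Definition bottom_functor : Functor (ProjCat delta p n) (IDMCat io q t sigma delta).
Proof.
exists bottom_IDM bottom_hom.
- by move=> M; apply: IDMhom_eq.
- by move=> M N P g f; apply: IDMhom_eq.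
Defined.

End Descent.

(** * The two natural isomorphisms *)

Section Equivalence.
Variables (C : closedFieldType) (p : nat) (hp : p \in [pchar C]).
Variables (n : nat) (hn : (2 <= n)%N) (q : C) (hq : n.-primitive_root q).
Variables (L : fieldType) (io : {rmorphism C -> L}) (t : L).
Variables (sigma : {rmorphism L -> L}) (delta : nat -> L -> L).
Hypothesis hL : iterative_qdiff_field io q t sigma delta.
Local Notation Lk := (Lk delta p n).
Local Notation IDMC := (IDMCat io q t sigma delta).
Local Notation ProjC := (ProjCat delta p n).
Local Notation hsys := (horizontal_system hp hn hq hL).
Local Notation bIDM := (bottom_IDM hp hn hq hL).

Lemma IDMhom_isIso (M N : Ob IDMC) (f : Defs.Hom M N) (g : idm_space N -> idm_space M) :
  cancel (sval f) g -> cancel g (sval f) -> isIso f.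
Proof.
move=> fK gK; have gP : IDMhom_prop g.
  split=> [a x y|k x]; apply: (can_inj fK); rewrite !gK.
    by rewrite (proj2_sig f).1 !gK.
  by rewrite (proj2_sig f).2 gK.
by exists (exist _ _ gP); split; apply: IDMhom_eq => x /=; rewrite ?fK ?gK.
Qed.

Lemma Projhom_isIso (M N : Ob ProjC) (f : Defs.Hom M N)
    (g : forall k, ks_car (pN N k) -> ks_car (pN M k)) :
  (forall k, cancel (sval f k) (g k)) -> (forall k, cancel (g k) (sval f k)) -> isIso f.
Proof.
move=> fK gK; have gP : @Projhom_prop _ _ _ _ N M g.
  split=> [k a x y ak|k x]; apply: (can_inj (fK _)); rewrite !gK.
    by rewrite (proj2_sig f).1 // !gK.
  by rewrite (proj2_sig f).2 gK.
by exists (exist _ _ gP); split; apply: Projhom_eq => k x /=; rewrite ?fK ?gK.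
Qed.

Section Unit.
Variable N : ProjObj delta p n.

Let lift_ex k (u : horizontal p n (bIDM N) k) : in_level k (val u).
Proof. by apply/(in_level_horizontal hp hn hq hL); case: u. Qed.

(** The chosen preimage is unique by [to_bottom_inj], so its properties can be checked after
    [to_bottom]. *)
Definition level_lift k (u : horizontal p n (bIDM N) k) : ks_car (pN N k) :=
  sval (cid (lift_ex u)).

Lemma level_liftK k (u : horizontal p n (bIDM N) k) : to_bottom (level_lift u) = val u.
Proof. by rewrite /level_lift; case: cid. Qed.

Lemma level_lift_hom : @Projhom_prop _ delta p n (hsys (bIDM N)) N level_lift.
Proof.
split=> [k a x y ak|k x]; apply: (to_bottom_inj hp hn hq hL).
  rewrite (to_bottom_lin hp hn hq hL) // !level_liftK horizontal_valD.
  by rewrite (val_horizontal_scale hp hn hq hL).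
by rewrite level_liftK -/(to_bottom (pPsi _)) -[RHS]/(to_bottom (level_lift x)) level_liftK.
Qed.

Definition level_lift_Projhom : Projhom (hsys (bIDM N)) N := exist _ _ level_lift_hom.

Lemma level_lift_iso : @isIso ProjC (hsys (bIDM N)) N level_lift_Projhom.
Proof.
have hx k (x : ks_car (pN N k)) : to_bottom x \in horizontal_pred p n (bIDM N) k.
  by apply/(in_level_horizontal hp hn hq hL); exists x.
apply: (@Projhom_isIso (hsys (bIDM N)) N level_lift_Projhom (fun k x => Horizontal (hx k x))) => k x /=.
  by apply: val_inj => /=; rewrite level_liftK.
by apply: (to_bottom_inj hp hn hq hL); rewrite level_liftK.
Qed.
End Unit.

Section Counit.
Variable M : IDMobj io q t sigma delta.

(** The transition maps of this system are inclusions. *)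
Lemma val_to_bottom k (x : horizontal p n M k) :
  val (@to_bottom _ _ _ _ (hsys M) k x : horizontal p n M 0) = val x.
Proof. by elim: k x => //= k IH x; rewrite IH. Qed.

(** The descended and the original derivations agree because, on multiples of vectors of level
    [k.+1], both differentiate the coefficient only. *)
Lemma horizontal_val_hom :
  @IDMhom_prop _ _ io q t sigma delta (bIDM (hsys M)) M (@horizontal_val _ p n _ _ _ _ _ _ M 0).
Proof.
have valZ (a : L) (x : bottom (hsys M)) :
    val (a *: x : horizontal p n M 0) = a *: val (x : horizontal p n M 0).
  by rewrite (val_horizontal_scale hp hn hq hL).
split=> [a x y|k x].
  by apply: etrans (horizontal_valD _ _) _; rewrite valZ.
elim/(@bottom_level_ind _ p hp n hn q hq _ _ _ _ _ hL (hsys M) k.+1): x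
  => [|u v IHu IHv|a v [x xv]].
- by rewrite [X in horizontal_val X]bottom_delta0 idm_delta_x0.
- rewrite [X in horizontal_val X]bottom_deltaD.
  apply: etrans (horizontal_valD _ _) _.
  rewrite [X in idm_delta _ X](horizontal_valD u v) idm_deltaD; congr (_ + _); [exact: IHu|exact: IHv].
have kk := ltn_order hp hn k.
rewrite [X in horizontal_val X](bottom_deltaZ_level hp hn hq hL _ kk); last by exists x.
rewrite [LHS]valZ [X in idm_delta _ X]valZ -xv val_to_bottom.
by rewrite (idm_deltaZ_horizontal _ kk) //; case: (x).
Qed.

Definition horizontal_val_IDMhom : IDMhom (bIDM (hsys M)) M := exist _ _ horizontal_val_hom.

Lemma horizontal_val_iso : @isIso IDMC (bIDM (hsys M)) M horizontal_val_IDMhom.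
Proof.
(* [order 0] is 1, so level 0 imposes no condition and is all of [M]. *)
have m0 (m : idm_space M) : m \in horizontal_pred p n M 0.
  by apply/horizontalP => -[].
apply: (@IDMhom_isIso (bIDM (hsys M)) M horizontal_val_IDMhom (fun m => Horizontal (m0 m))) => x //=.
exact: val_inj.
Qed.
End Counit.
End Equivalence.

Theorem theorem3p9 (C : closedFieldType) (p : nat) (hp : p \in [pchar C])
  (n : nat) (hn : (2 <= n)%N) (q : C) (hq : n.-primitive_root q)
  (L : fieldType) (iota : {rmorphism C -> L}) (t : L)
  (sigma : {rmorphism L -> L}) (delta : nat -> L -> L)
  (hL : iterative_qdiff_field iota q t sigma delta) :
  EquivalentCategories (ProjCat delta p n) (IDMCat iota q t sigma delta).
Proof.
exists (bottom_functor hp hn hq hL), (horizontal_functor hp hn hq hL); split.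
  exists (level_lift_Projhom hp hn hq hL); split; last exact: level_lift_iso.
  move=> M N f; apply: Projhom_eq => k x /=.
  apply: (to_bottom_inj hp hn hq hL).
  by rewrite -Projhom_to_bottom !level_liftK.
exists (horizontal_val_IDMhom hp hn hq hL); split; last exact: horizontal_val_iso.
by move=> M N f; apply: IDMhom_eq.
Qed.
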